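(* For every $N\in\mathbb{N}$ with $N>1$, every $\bar\tau>0$, $\omega>0$ and $\varepsilon\in(-1,0)$, the hybrid system $\mathcal{H}_N$ is such that the compact set $\mathcal{A}$ (the desynchronization set) is (1) asymptotically stable with basin of attraction given by $\mathcal{B}_{\mathcal{A}}:=P_N\setminus\mathcal{X}$; and (2) weakly globally asymptotically stable.
   Context: **The hybrid system $\mathcal{H}_N$.** Let $N\ge 2$ be an integer, $\bar\tau>0$, $\omega>0$, $\varepsilon\in(-1,0)$, $I=\{1,\dots,N\}$, $P_N=[0,\bar\tau]^N$, and let $\mathbf 1\in\mathbb{R}^N$ be the vector of ones. $\mathcal{H}_N=(C,f,D,G)$ has state $\tau=(\tau_1,\dots,\tau_N)$, with $\dot\tau=f(\tau)$ for $\tau\in C$ and $\tau^+\in G(\tau)$ for $\tau\in D$, where $C=P_N$, $f(\tau)=\omega\mathbf 1$, $D=\{\tau\in P_N:\exists i\in I,\ \tau_i=\bar\tau\}$, and for $\tau\in D$, $G(\tau)=g_1(\tau)\times\cdots\times g_N(\tau)$ (vectors whose $i$-th component lies in $g_i(\tau)$) with - $g_i(\tau)=\{0\}$ if $\tau_i=\bar\tau$ and $\tau_r<\bar\tau$ for all $r\in I\setminus\{i\}$; - $g_i(\tau)=\{0,(1+\varepsilon)\tau_i\}$ if $\tau_i=\bar\tau$ and there is $r\in I\setminus\{i\}$ with $\tau_r=\bar\tau$; - $g_i(\tau)=\{(1+\varepsilon)\tau_i\}$ if $\tau_i<\bar\tau$ and there is $r\in I\setminus\{i\}$ with $\tau_r=\bar\tau$.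 **Solutions.** A compact hybrid time domain is a set $\bigcup_{j=0}^{J-1}([t_j,t_{j+1}]\times\{j\})$ with $0=t_0\le t_1\le\dots\le t_J$; a set $S\subset\mathbb{R}_{\ge0}\times\mathbb{N}$ is a hybrid time domain if $S\cap([0,T]\times\{0,\dots,J\})$ is a compact hybrid time domain for every $(T,J)\in S$. A hybrid arc is a function $x$ on a hybrid time domain $\operatorname{dom}x$ such that $t\mapsto x(t,j)$ is locally absolutely continuous for each $j$. It is a solution if $x(0,0)\in C\cup D$; for all $j$ and almost all $t$ with $(t,j)\in\operatorname{dom}x$, $x(t,j)\in C$ and $\dot x(t,j)=f(x(t,j))$; and whenever $(t,j),(t,j+1)\in\operatorname{dom}x$, $x(t,j)\in D$ and $x(t,j+1)\in G(x(t,j))$. A solution is maximal if it is not a proper truncation of another solution, and complete if its domain is unbounded. **The set $\mathcal{X}$.** $\mathcal{X}=\mathcal{S}\cup\mathcal{G}$, where $\mathcal{S}=\{\tau\in P_N:\exists i,r\in I,\ i\ne r,\ \tau_i=\tau_r\}$ and $\mathcal{G}=\{\tau\in D\setminus\mathcal{S}:\exists i,r\in I,\ i\neq r,\ \tau_i=0,\ \tau_r=\bar\tau\}$. **The desynchronization set $\mathcal{A}$.** Let $\Gamma$ be the $N\times N$ matrix whose first row is $(1,0,\dots,0)$; whose second row has entry $2+\varepsilon$ in column 2, $-(1+\varepsilon)$ in column 3 (if $N\ge3$), and zeros elsewhere; and whose $k$-th row, $3\le k\le N$, has entry $1+\varepsilon$ in column 2, $1$ in column $k$, $-(1+\varepsilon)$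 in column $k+1$ (if $k<N$), and zeros elsewhere. Let $\tau_s\in\mathbb{R}^N$ be the solution of $\Gamma\tau_s=\bar\tau\mathbf 1$ (its entries are in decreasing order). Let $\tilde\tau^1,\dots,\tilde\tau^{N!}$ be the $N!$ points obtained by permuting the components of $\tau_s$ in all possible ways. Set $\ell_k=\{\tau\in P_N:\tau=\tilde\tau^k+s\mathbf 1,\ s\in\mathbb{R}\}$ and $\mathcal{A}=\bigcup_{k=1}^{N!}\ell_k$. **Stability notions.** $|x|_{\mathcal{A}}=\min_{z\in\mathcal{A}}|x-z|$ (Euclidean norm). A closed set $\mathcal{A}$ is: *stable* if for each $\epsilon>0$ there is $\delta>0$ such that every solution $x$ with $|x(0,0)|_{\mathcal{A}}\le\delta$ satisfies $|x(t,j)|_{\mathcal{A}}\le\epsilon$ for all $(t,j)\in\operatorname{dom}x$; *attractive* if there is $\mu>0$ such that every maximal solution $x$ with $|x(0,0)|_{\mathcal{A}}\le\mu$ is complete and satisfies $\lim_{(t,j)\in\operatorname{dom}x,\ t+j\to\infty}|x(t,j)|_{\mathcal{A}}=0$; *asymptotically stable* if stable and attractive; *weakly globally asymptotically stable* if it is stable and, for every initial condition (in $C\cup D$), there exists a maximal solution that is complete and satisfies $\lim_{(t,j)\in\operatorname{dom}x,\ t+j\to\infty}|x(t,j)|_{\mathcal{A}}=0$. The *basin of attraction* is the set of initial points from which every maximal solution is complete and converges to $\mathcal{A}$ in this sense. *)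

(* Defs.v *)
(* Conventions. R^N is 'cV[R]_N, whose library norm is the sup norm; the
   Euclidean norm is [enorm]. Indices are 0-based ('I_N stands for {1, ..., N}). *)
From HB Require Import structures.
From mathcomp Require Import all_boot all_order all_algebra all_fingroup.
From mathcomp Require Import all_classical all_reals all_analysis.
From mathcomp Require Import ring lra zify.

Set Implicit Arguments.
Unset Strict Implicit.
Unset Printing Implicit Defensive.

Import Order.TTheory GRing.Theory Num.Theory.
Import numFieldNormedType.Exports.

Local Open Scope classical_set_scope.
Local Open Scope ring_scope.

Section euclidean.
Context {R : realType} {n : nat}.
Implicit Types (x : 'cV[R]_n) (A : set 'cV[R]_n).

Definition enorm x : R := Num.sqrt (\sum_(i < n) x i 0 ^+ 2).

(* The infimum is attained when A is closed and nonempty. *)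
Definition edist A x : R := inf [set enorm (x - z) | z in A].

Definition abs_continuous (a b : R) (g : R -> 'cV[R]_n) : Prop :=
  forall e : R, 0 < e -> exists2 d : R, 0 < d &
    forall (m : nat) (u v : 'I_m -> R),
      (forall k, a <= u k /\ u k <= v k /\ v k <= b) ->
      trivIset setT (fun k => `]u k, v k[%classic) ->
      \sum_(k < m) (v k - u k) < d ->
      \sum_(k < m) enorm (g (v k) - g (u k)) < e.

End euclidean.

Section hybrid_systems.
Context {R : realType} {n : nat}.

Record hybrid_system := HybridSystem {
  flow_set : set 'cV[R]_n;
  flow_map : 'cV[R]_n -> 'cV[R]_n;
  jump_set : set 'cV[R]_n;
  jump_map : 'cV[R]_n -> set 'cV[R]_n }.

Definition compact_hybrid_time_domain (S : set (R * nat)) : Prop :=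
  exists (J : nat) (t : nat -> R),
    [/\ t 0%N = 0, (forall j, (j < J)%N -> t j <= t j.+1) &
      S = [set p | (p.2 < J)%N /\ t p.2 <= p.1 <= t p.2.+1]].

Definition hybrid_time_domain (S : set (R * nat)) : Prop :=
  (forall p, S p -> 0 <= p.1) /\
  forall T J, S (T, J) ->
    compact_hybrid_time_domain (S `&` (`[0, T] `*` [set j | (j <= J)%N])).

(* A function on [hdom], totalized: the values of [hval] outside of [hdom]
   are irrelevant, and none of the notions below depends on them. *)
Record hybrid_fun := HybridFun {
  hdom : set (R * nat);
  hval : R -> nat -> 'cV[R]_n }.

Implicit Types (x y : hybrid_fun) (H : hybrid_system) (A : set 'cV[R]_n).

Definition hybrid_arc x : Prop :=
  hybrid_time_domain (hdom x) /\
  forall (j : nat) (a b : R), `[a, b] `<=` [set t | hdom x (t, j)] ->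
    abs_continuous a b (fun t => hval x t j).

(* The two-sided derivative is meaningful because only finitely many t, the
   endpoints of the interval {t | (t, j) \in dom x}, are not interior to it. *)
Definition solution H x : Prop :=
  [/\ hybrid_arc x,
      hdom x (0, 0%N) /\ (flow_set H `|` jump_set H) (hval x 0 0%N),
      (forall j : nat, {ae lebesgue_measure, forall t : R, hdom x (t, j) ->
         flow_set H (hval x t j) /\
         is_derive t 1 (fun s : R => hval x s j) (flow_map H (hval x t j))}) &
      (forall (t : R) (j : nat), hdom x (t, j) -> hdom x (t, j.+1) ->
         jump_set H (hval x t j) /\
         jump_map H (hval x t j) (hval x t j.+1))].

Definition proper_truncation x y : Prop :=
  hdom x `<` hdom y /\
  forall t j, hdom x (t, j) -> hval x t j = hval y t j.

Definition maximal_solution H x : Prop :=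
  solution H x /\ ~ exists y, solution H y /\ proper_truncation x y.

Definition complete_arc x : Prop :=
  ~ exists M : R, forall t j, hdom x (t, j) -> t + j%:R <= M.

Definition converges_to A x : Prop :=
  forall e : R, 0 < e -> exists M : R, forall t j,
    hdom x (t, j) -> M <= t + j%:R -> edist A (hval x t j) < e.

Definition stable H A : Prop :=
  forall e : R, 0 < e -> exists2 d : R, 0 < d &
    forall x, solution H x -> edist A (hval x 0 0%N) <= d ->
      forall t j, hdom x (t, j) -> edist A (hval x t j) <= e.

Definition attractive H A : Prop :=
  exists2 mu : R, 0 < mu &
    forall x, maximal_solution H x -> edist A (hval x 0 0%N) <= mu ->
      complete_arc x /\ converges_to A x.

Definition asymptotically_stable H A : Prop := stable H A /\ attractive H A.

(* Initial points are points of C `|` D: without this restriction, every point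
   outside of C `|` D would belong to the basin vacuously. *)
Definition basin_of_attraction H A : set 'cV[R]_n :=
  [set p | (flow_set H `|` jump_set H) p /\
    forall x, maximal_solution H x -> hval x 0 0%N = p ->
      complete_arc x /\ converges_to A x].

Definition weakly_globally_asymptotically_stable H A : Prop :=
  stable H A /\
  forall p, (flow_set H `|` jump_set H) p ->
    exists x, [/\ maximal_solution H x, hval x 0 0%N = p,
                  complete_arc x & converges_to A x].

End hybrid_systems.
Arguments hybrid_system : clear implicits.
Arguments hybrid_fun : clear implicits.

Section impulse_coupled_oscillators.
Context {R : realType} (N : nat) (taubar omega eps : R).
Implicit Types tau : 'cV[R]_N.

Definition cube : set 'cV[R]_N := [set tau | forall i, 0 <= tau i 0 <= taubar].

Definition osc_jump_set : set 'cV[R]_N :=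
  [set tau | cube tau /\ exists i, tau i 0 = taubar].

Definition osc_jump_comp (i : 'I_N) tau : set R :=
  [set y |
    [\/ [/\ tau i 0 = taubar, (forall r, r != i -> tau r 0 < taubar) & y = 0],
        [/\ tau i 0 = taubar, (exists r, r != i /\ tau r 0 = taubar) &
            y = 0 \/ y = (1 + eps) * tau i 0] |
        [/\ tau i 0 < taubar, (exists r, r != i /\ tau r 0 = taubar) &
            y = (1 + eps) * tau i 0]]].

Definition osc_jump_map tau : set 'cV[R]_N :=
  [set y | forall i, osc_jump_comp i tau (y i 0)].

Definition oscillators : hybrid_system R N := {|
  flow_set := cube;
  flow_map := fun=> const_mx omega;
  jump_set := osc_jump_set;
  jump_map := osc_jump_map |}.

Definition coincidence_set : set 'cV[R]_N :=
  [set tau | cube tau /\ exists i r, i != r /\ tau i 0 = tau r 0].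

Definition zero_max_set : set 'cV[R]_N :=
  [set tau | (osc_jump_set `\` coincidence_set) tau /\
    exists i r, [/\ i != r, tau i 0 = 0 & tau r 0 = taubar]].

Definition bad_set : set 'cV[R]_N := coincidence_set `|` zero_max_set.

Definition desync_mx : 'M[R]_N :=
  \matrix_(i < N, j < N)
    if i == 0%N :> nat then (j == 0%N :> nat)%:R
    else if i == 1%N :> nat then
      if j == 1%N :> nat then 2 + eps
      else if j == 2%N :> nat then - (1 + eps)
      else 0
    else
      if j == 1%N :> nat then 1 + eps
      else if j == i then 1
      else if j == i.+1 :> nat then - (1 + eps)
      else 0.

(* [desync_mx] is invertible, see [desync_ptP] and [desync_pt_uniq] below. *)
Definition desync_pt : 'cV[R]_N := invmx desync_mx *m const_mx taubar.

Definition desync_line (s : 'S_N) : set 'cV[R]_N :=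
  [set tau | cube tau /\
    exists c : R, tau = row_perm s desync_pt + const_mx c].

Definition desync_set : set 'cV[R]_N := \bigcup_(s : 'S_N) desync_line s.

End impulse_coupled_oscillators.
Arguments cube {R} N taubar _.
Arguments bad_set {R} N taubar _.
Arguments desync_set {R} N taubar eps _.

Section desync_point.
Context {R : realType} (N : nat) (eps : R).
Hypotheses (N_gt1 : (1 < N)%N) (eps_itv : -1 < eps < 0).

Lemma desync_mx_unit : desync_mx N eps \in unitmx.
Proof.
rewrite -unitmx_tr -row_free_unit; apply/inj_row_free => u ukr.
pose v j := u 0 j.
pose w k := \sum_(j < N) (j == k :> nat)%:R * v j.
pose a := 1 + eps.
have wE (i : 'I_N) : w i = v i.
  rewrite /w (bigD1 i) //= eqxx mul1r big1 ?addr0 // => j ji.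
  by rewrite -val_eqE in ji; rewrite (negbTE ji) mul0r.
have wN : w N = 0.
  by rewrite /w big1 // => j _; rewrite (ltn_eqF (ltn_ord j)) mul0r.
have row_eq (i : 'I_N) : \sum_(j < N) v j * desync_mx N eps i j = 0.
  move/rowP/(_ i): ukr; rewrite !mxE => {2}<-.
  by apply: eq_bigr => j _; rewrite !mxE.
have w0 : w 0%N = 0.
  rewrite -(row_eq (Ordinal (ltnW N_gt1))); apply: eq_bigr => j _.
  by rewrite mxE /= mulrC.
have rec k : (k < N)%N -> w k = a * (w k.+1 - w 1%N).
  case: k => [|k] kN; first by rewrite w0 subrr mulr0.
  apply/eqP; rewrite -subr_eq0; apply/eqP.
  rewrite -(row_eq (Ordinal kN)) /w -sumrB mulr_sumr -sumrB.
  apply: eq_bigr => j _; rewrite mxE /= -/a -val_eqE /=.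
  case: k kN => [|k] kN /=.
    by case: eqVneq => [->|_] /=; [|case: eqVneq => _ /=]; rewrite /a; ring.
  case: (eqVneq (nat_of_ord j) 1%N) => [->|_] /=; first by ring.
  case: (eqVneq (nat_of_ord j) k.+2) => [->|_] /=.
    by rewrite (ltn_eqF (ltnSn _)) /=; ring.
  by case: eqVneq => _ /=; ring.
pose L := w N.-1.
have gap m : (m < N)%N -> w (N - m.+1)%N - w (N - m)%N = a ^+ m * L.
  elim: m => [|m IH] mN; first by rewrite subn1 subn0 wN expr0 mul1r subr0.
  rewrite exprS -mulrA -IH ?(ltnW mN) //.
  have e1 : (N - m.+2).+1 = (N - m.+1)%N by lia.
  have e2 : (N - m.+1).+1 = (N - m)%N by lia.
  rewrite rec ?e1; last by lia.
  rewrite (rec (N - m.+1)%N) ?e2; last by lia.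
  by ring.
have wsum m : (m <= N)%N -> w (N - m)%N = L * \sum_(i < m) a ^+ i.
  elim: m => [|m IH] mN; first by rewrite subn0 big_ord0 wN mulr0.
  rewrite big_ord_recr /= mulrDr -IH ?(ltnW mN) //.
  by have := gap m mN => /(canRL (subrK _)) ->; rewrite mulrC addrC.
have a_gt0 : 0 < a by rewrite /a; case/andP: eps_itv => ? _; lra.
have S_gt0 : 0 < \sum_(i < N) a ^+ i.
  rewrite (bigD1 (Ordinal (ltnW N_gt1))) //= expr0 ltr_pwDl //.
  by apply: sumr_ge0 => i _; rewrite exprn_ge0 // ltW.
have L0 : L = 0.
  have := wsum N (leqnn N); rewrite subnn w0 => /esym/eqP.
  by rewrite mulf_eq0 (gt_eqF S_gt0) orbF => /eqP.
apply/rowP => i; rewrite mxE -/(v i) -wE.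
have iE : nat_of_ord i = (N - (N - i))%N by have := ltn_ord i; lia.
by rewrite iE wsum ?leq_subr // L0 mul0r.
Qed.

Lemma desync_ptP (taubar : R) :
  desync_mx N eps *m desync_pt N taubar eps = const_mx taubar.
Proof. by rewrite /desync_pt mulKVmx // desync_mx_unit. Qed.

Lemma desync_pt_uniq (taubar : R) (p : 'cV[R]_N) :
  desync_mx N eps *m p = const_mx taubar -> p = desync_pt N taubar eps.
Proof. by move=> h; rewrite /desync_pt -h mulKmx // desync_mx_unit. Qed.

End desync_point.

(* Main.v *)
Require Import Defs.
From mathcomp Require Import all_boot all_order all_algebra all_fingroup.
From mathcomp Require Import all_classical all_reals all_analysis.
From mathcomp Require Import ring lra zify.
Import Order.TTheory GRing.Theory Num.Theory.
Import numFieldNormedType.Exports.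
Local Open Scope classical_set_scope.
Local Open Scope ring_scope.

Set Implicit Arguments.
Unset Strict Implicit.
Unset Printing Implicit Defensive.

(* [edist] also names the extended distance of a metric space. *)
Local Notation edist := Defs.edist.

(** Follow the gaps between consecutive phases rather than the phases. List
the oscillators by decreasing phase, around a circle of length [taubar], so
that there are N cyclic gaps of sum [taubar]; the last one runs from the lowest
oscillator back to the highest. Flowing moves all phases together and leaves
the gaps unchanged. With a = 1 + eps, a jump sends the highest oscillator to 0
and multiplies the other phases by a; relative to the cyclic order started one
step later, the new gap at k is a times the old gap at k + 1, plus
(1 - a) * taubar at the last position ([gap_reset_top]). This affine map is a
shift composed with the scaling by a, hence contracts the sup distance to its
fixed point ([ideal_gap_fix], [gap_close_reset_top]). The fixed point is the
geometric sequence of the gaps of [desync_pt], so the points of the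
desynchronization set are those with ideal gaps, and for points of the cube
the distance to this set and the deviation of the gaps from the ideal ones
control each other ([edist_le_gap_close], [edist_lt_gap_close]).

At a point of the cube outside of [bad_set] all the cyclic gaps are positive,
for the order of decreasing phases ([exists_well_spaced]). Flows
and jumps preserve this, and then a single oscillator is at [taubar] at each
jump, which makes the jump deterministic. The solution is therefore unique: any
solution is a restriction of one explicit trajectory, defined for all numbers
of jumps ([solution_sub_trajectory]). That trajectory is complete, so a maximal
solution is equal to it, and its gaps converge geometrically. This gives
stability, attractivity and one inclusion of the basin.

When several phases coincide the same computation applies with weakly
decreasing phases: break the ties arbitrarily and let exactly one oscillator
at [taubar] return to 0 at each jump. This choice is allowed by the jump map
and still contracts the gaps ([desync_traj_converges]), hence weak global
attractivity. If instead every oscillator at [taubar] returns to 0, then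
coinciding phases coincide forever and a point of [bad_set] has a coincidence
after at most one jump; as neighbours of the desynchronization set have
distinct phases, that solution does not converge ([bad_not_basin]).

The one analytic ingredient is that an absolutely continuous function with
constant derivative almost everywhere is affine ([ac_derive_const]), which
identifies the flows of an arbitrary solution. *)

(** * Analytic preliminaries *)

(** A form of Cousin's lemma: a property that can be carried across a
neighbourhood of every point of [a, b], from the left of the point to its
right, reaches b. The supremum of the points where it holds cannot lie
before b. *)
Lemma cousin_step {R : realType} (a b : R) (Q : R -> Prop) : a <= b -> Q a ->
  (forall x, a <= x <= b -> exists2 d : R, 0 < d &
     forall y z, a <= y <= x -> x <= z <= b -> x - d < y -> z < x + d ->
       Q y -> Q z) ->
  Q b.
Proof.
move=> ab Qa step; pose E := [set x | a <= x <= b /\ Q x].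
have Ea : E a by split=> //; rewrite lexx.
have Eub : has_ubound E by exists b => x [/andP[]].
have Esup : has_sup E by split=> //; exists a.
pose c := sup E.
have ac : a <= c by apply: ub_le_sup.
have cb : c <= b by apply: ge_sup; [exists a | move=> x [/andP[]]].
have [d d0 stepc] := step c (introT andP (conj ac cb)).
have [y [/andP[ay yb] Qy] cdy] := sup_adherent d0 Esup.
have yc : y <= c by apply: ub_le_sup => //; split=> //; rewrite ay.
have Qz z : c <= z <= b -> z < c + d -> Q z.
  by move=> cz zd; apply: (stepc y) => //; rewrite ay.
have [bcd|cdb] := ltP b (c + d); first by apply: Qz; rewrite // cb lexx.
have : E (c + d / 2) by split; [|apply: Qz]; lra.
by move/(ub_le_sup Eub); rewrite -/c; lra.
Qed.

Lemma is_derive_entry {R : realType} {n : nat} (g : R -> 'cV[R]_n) (x : R)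
    (v : 'cV[R]_n) (i : 'I_n) (e : R) : 0 < e -> is_derive x 1 g v ->
  exists2 d : R, 0 < d & forall y, `|y - x| < d ->
    `|g y i 0 - g x i 0 - v i 0 * (y - x)| <= e * `|y - x|.
Proof.
move=> e0 [dg]; rewrite /derive => gv; move: dg; rewrite /derivable.
move/cvgrPdist_lt => /(_ e e0); rewrite gv.
case/nbhs_ballP => d /= d0 H; exists d => // y yd.
have [->|yx] := eqVneq y x; first by rewrite !subrr mulr0 subr0 normr0 mulr0.
have h0 : y - x != 0 by rewrite subr_eq0.
have /= := H (y - x).
rewrite -ball_normE /= sub0r normrN => /(_ yd h0).
rewrite /= /shift /= /GRing.scale /= mulr1 subrK.
set w := v - _ => wlt.
have wi : `|w i 0| < e.
  apply: le_lt_trans wlt; rewrite /Num.Def.normr /= mx_normrE.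
  exact: (le_bigmax_cond _ (fun ij => `|w ij.1 ij.2|) (j := (i, 0))).
rewrite (_ : g y i 0 - g x i 0 - v i 0 * (y - x) = - ((y - x) * w i 0)).
  by rewrite normrN normrM mulrC ler_wpM2r // ltW.
by rewrite /w !mxE; field.
Qed.

Lemma null_set_outer {R : realType} (E : set R) (d : R) : 0 < d ->
  (@lebesgue_measure R).-negligible E ->
  exists U : set R, [/\ open U, E `<=` U & (lebesgue_measure U < d%:E)%E].
Proof.
move=> d0 [M [mM M0 EM]].
have lM0 : lebesgue_measure M = 0%E by exact: M0.
have [|U [oU MU Ud]] := lebesgue_regularity_outer mM _ d0.
  exact: (eq_ind_r (fun x => (x < +oo)%E) (ltry 0) lM0).
exists U; split=> //; first exact: subset_trans MU.
have -> : U = M `|` (U `\` M) by rewrite setDUK.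
apply: le_lt_trans (measureU2 _ _ _) _ => //.
  by apply: measurableD => //; exact: measurable_realfun.open_measurable.
apply: le_lt_trans Ud; rewrite -[leRHS]add0e; apply: leeD2r.
exact: (eq_ind_r (fun x => (x <= 0)%E) (lexx _) lM0).
Qed.

Lemma sum_length_le {R : realType} (U : set R) (m : nat) (u v : 'I_m -> R) (d : R) :
  open U -> (lebesgue_measure U < d%:E)%E ->
  (forall k, u k <= v k) -> (forall k, `]u k, v k[ `<=` U) ->
  trivIset setT (fun k => `]u k, v k[%classic) ->
  \sum_(k < m) (v k - u k) < d.
Proof.
move=> oU Ud uv uvU tr; rewrite -lte_fin; apply: le_lt_trans Ud.
rewrite -sumEFin.
have -> : (\sum_(k < m) (v k - u k)%:E)%E =
    (\sum_(k < m) lebesgue_measure `]u k, v k[%classic)%E.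
  apply: eq_bigr => k _; rewrite lebesgue_measure_itv /= lte_fin.
  case: ltP => // vu; have -> : v k = u k by apply/eqP; rewrite eq_le vu uv.
  by rewrite subrr.
rewrite -measure_bigsetU_ord //.
apply: le_measure; rewrite ?inE.
- exact: bigsetU_measurable.
- exact: measurable_realfun.open_measurable.
- apply: (big_ind (fun X => X `<=` U)); first exact: sub0set.
    by move=> X Y XU YU; rewrite subUset; split.
  by move=> k _; apply: uvU.
Qed.

Lemma entry_le_enorm {R : realType} {n : nat} (x : 'cV[R]_n) (i : 'I_n) :
  `|x i 0| <= enorm x.
Proof.
rewrite -sqrtr_sqr; apply: ler_wsqrtr; rewrite (bigD1 i) //= lerDl.
by apply: sumr_ge0 => j _; apply: sqr_ge0.
Qed.

(** Gauge argument. Cover the exceptional null set by an open set U of small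
measure. Near a point outside of U the increments of g follow the slope w up
to a relative error e; near a point of U, record the whole interval as a piece
of U. The recorded intervals are disjoint, so by [sum_length_le] their total
length is small, and absolute continuity bounds the increments of g over them.
[cousin_step] patches the local estimates into one over [a, b]. *)
Lemma ac_derive_const {R : realType} {n : nat} (a b : R) (g : R -> 'cV[R]_n)
    (w : 'cV[R]_n) : a <= b -> abs_continuous a b g ->
  {ae @lebesgue_measure R, forall t, a <= t <= b -> is_derive t 1 g w} ->
  g b = g a + (b - a) *: w.
Proof.
move=> ab gac dg; apply/colP => i; rewrite !mxE.
suff H e : 0 < e -> `|g b i 0 - g a i 0 - w i 0 * (b - a)| <= e * (b - a) + e + e.
  apply/eqP; rewrite mulrC -subr_eq0 opprD addrA -normr_le0.
  apply/ler_addgt0Pr => e e0; rewrite add0r.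
  have ba0 : 0 < b - a + 2 by lra.
  apply: le_trans (H (e / (b - a + 2)) _) _; first exact: divr_gt0.
  by rewrite le_eqVlt; apply/orP; left; apply/eqP; field; lra.
move=> e0; have [d0 d00 gd] := gac e e0.
set W := `|w i 0|; have W0 : 0 <= W by apply: normr_ge0.
(* The second term makes the linear part negligible on the pieces of U. *)
pose d := Num.min d0 (e / (W + 1)).
have d_gt0 : 0 < d by rewrite lt_min d00 divr_gt0 // ltr_wpDl.
have Wd : W * d <= e.
  have dle : d <= e / (W + 1) by rewrite ge_min lexx orbT.
  apply: le_trans (ler_wpM2l W0 dle) _; rewrite mulrCA ger_pMr //.
  by rewrite ler_pdivrMr; lra.
have [U [oU EU Ud]] := null_set_outer d_gt0 dg.
pose D (k : nat) (u v : nat -> R) := `|g (v k) i 0 - g (u k) i 0| + W * (v k - u k) : R.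
pose Q x := exists (m : nat) (u v : nat -> R),
  [/\ forall k, (k < m)%N -> [/\ a <= u k, u k <= v k & v k <= x],
      forall k l, (k < l < m)%N -> v k <= u l,
      forall k, (k < m)%N -> `]u k, v k[ `<=` U &
      `|g x i 0 - g a i 0 - w i 0 * (x - a)| <=
        e * (x - a) + \sum_(k < m) D k u v].
have Qb : Q b.
  apply: (@cousin_step _ a b) => //.
    exists 0%N, (fun=> a), (fun=> a); split=> //.
    by rewrite !subrr !mulr0 subr0 normr0 big_ord0 addr0.
  move=> x /andP[ax xb]; have [Ux|nUx] := pselect (U x).
    have [d1 /= d10 d1U] : nbhs x U by apply: open_nbhs_nbhs.
    exists d1 => // y z /andP[ay yx] /andP[xz zb] xdy zxd [m [u [v [uv mono uvU le]]]].
    pose u' k := if (k < m)%N then u k else y.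
    pose v' k := if (k < m)%N then v k else z.
    exists m.+1, u', v'; split.
    - move=> k _; rewrite /u' /v'; case: ifP => km.
        by have [? ? ?] := uv k km; split=> //; lra.
      by split; lra.
    - move=> k l /andP[kl lm]; rewrite /u' /v'.
      have km : (k < m)%N by exact: leq_trans kl _.
      rewrite km; case: ifP => lm'; first by apply: mono; rewrite kl.
      by have [? ? ?] := uv k km; lra.
    - move=> k _; rewrite /u' /v'; case: ifP => km; first exact: uvU.
      move=> t /=; rewrite in_itv /= => /andP[yt tz]; apply: d1U => /=.
      by rewrite ltr_distlC; apply/andP; split; lra.
    - rewrite big_ord_recr /=.
      have -> : D m u' v' = `|g z i 0 - g y i 0| + W * (z - y).
        by rewrite /D /u' /v' ltnn.
      have -> : \sum_(k < m) D k u' v' = \sum_(k < m) D k u v.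
        by apply: eq_bigr => k _; rewrite /D /u' /v' ltn_ord.
      have : `|g z i 0 - g a i 0 - w i 0 * (z - a)| <=
          `|g y i 0 - g a i 0 - w i 0 * (y - a)| +
          (`|g z i 0 - g y i 0| + W * (z - y)).
        have -> : W * (z - y) = `| w i 0 * (z - y)|.
          by rewrite normrM (@ger0_norm _ (z - y)) //; lra.
        apply: le_trans (lerD (lexx _) (ler_normB _ _)).
        apply: le_trans (ler_normD _ _); rewrite le_eqVlt; apply/orP; left.
        by apply/eqP; congr (`|_|); ring.
      move=> H; apply: le_trans H _; rewrite [leRHS]addrA lerD2r.
      apply: le_trans le _; rewrite lerD2r ler_wpM2l //; lra.
  have [d1 d10 Hd] : exists2 d1 : R, 0 < d1 & forall y, `|y - x| < d1 ->
    `|g y i 0 - g x i 0 - w i 0 * (y - x)| <= e * `|y - x|.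
    apply: is_derive_entry => //; apply: contrapT => H; apply: nUx; apply: EU => /=.
    by move=> K; apply: H; apply: K; rewrite ax.
  exists d1 => // y z /andP[ay yx] /andP[xz zb] xdy zxd [m [u [v [uv mono uvU le]]]].
  exists m, u, v; split=> //.
    by move=> k km; have [? ? ?] := uv k km; split=> //; lra.
  have Hy := Hd y; have Hz := Hd z.
  rewrite distrC (@ger0_norm _ (x - y)) in Hy; last by lra.
  rewrite (@ger0_norm _ (z - x)) in Hz; last by lra.
  have {}Hy : `|g y i 0 - g x i 0 - w i 0 * (y - x)| <= e * (x - y) by apply: Hy; lra.
  have {}Hz : `|g z i 0 - g x i 0 - w i 0 * (z - x)| <= e * (z - x) by apply: Hz; lra.
  have -> : g z i 0 - g a i 0 - w i 0 * (z - a) =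
    (g y i 0 - g a i 0 - w i 0 * (y - a)) +
    ((g z i 0 - g x i 0 - w i 0 * (z - x)) - (g y i 0 - g x i 0 - w i 0 * (y - x))) by ring.
  apply: le_trans (ler_normD _ _) _; apply: le_trans (lerD le (ler_normB _ _)) _.
  by lra.
have {Qb} [m [u [v [uv mono uvU le]]]] := Qb.
apply: le_trans le _; rewrite -addrA lerD2l big_split /= -mulr_sumr.
have tr : trivIset setT (fun k : 'I_m => `]u k, v k[%classic).
  apply/trivIsetP => k l _ _ kl; apply/seteqP; split=> // t [/=].
  rewrite !in_itv /= => /andP[ukt tvk] /andP[ult tvl].
  have [klt|lkt|E] := ltngtP k l.
  - by have := mono k l; rewrite klt ltn_ord => /(_ isT); lra.
  - by have := mono l k; rewrite lkt ltn_ord => /(_ isT); lra.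
  - by move/eqP: kl; case; apply: val_inj.
have len : \sum_(k < m) (v k - u k) < d.
  apply: (sum_length_le oU Ud) => // k; last by apply: uvU.
  by have [] := uv k (ltn_ord k).
apply: lerD; last by apply: le_trans (ler_wpM2l W0 (ltW len)) Wd.
apply: le_trans (ltW (gd m (fun k => u k) (fun k => v k) _ tr _)).
- apply: ler_sum => k _.
  by have := entry_le_enorm (g (v k) - g (u k)) i; rewrite !mxE.
- by move=> k; have [] := uv k (ltn_ord k).
- by apply: lt_le_trans len _; rewrite ge_min lexx.
Qed.

Lemma add_constE {R : realType} m (x : 'cV[R]_m) c i :
  (x + const_mx c) i 0 = x i 0 + c.
Proof. by rewrite mxE [X in _ + X]mxE. Qed.

Lemma enorm_le {R : realType} m (x : 'cV[R]_m) (r : R) : 0 <= r ->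
  (forall i, `|x i 0| <= r) -> enorm x <= m%:R * r.
Proof.
move=> r0 H; rewrite -[leRHS]ger0_norm ?mulr_ge0 // -sqrtr_sqr.
apply: ler_wsqrtr; apply: le_trans (_ : m%:R * r ^+ 2 <= _).
  rewrite mulr_natl -[m in leRHS]card_ord -sumr_const; apply: ler_sum => i _.
  by rewrite -[_ ^+ 2]real_normK ?num_real // lerXn2r ?nnegrE.
rewrite exprMn ler_wpM2r ?sqr_ge0 // -natrX ler_nat.
by case: m {x H} => // m; rewrite expnS expn1 leq_pmulr.
Qed.

Lemma ae_exists_between {R : realType} (P : R -> Prop) (u v : R) :
  {ae @lebesgue_measure R, forall t, P t} -> u < v -> exists2 t, u < t < v & P t.
Proof.
move=> aeP uv; apply: contrapT => nP.
have [U [oU PU Ud]] : exists U : set R,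
    [/\ open U, ~` [set t | P t] `<=` U & (lebesgue_measure U < (v - u)%:E)%E].
  by apply: null_set_outer => //; rewrite subr_gt0.
have := @sum_length_le R U 1 (fun=> u) (fun=> v) _ oU Ud.
rewrite big_ord1 ltxx => K; suff : false by []; apply: K => [_|k t|].
- exact: ltW.
- rewrite /= in_itv /= => utv; apply: PU => /= Pt; apply: nP; by exists t.
- by move=> i j _ _ _; rewrite !ord1.
Qed.

(** * Hybrid time domains *)

Section time_domains.
Context {R : realType}.
Implicit Types (S : set (R * nat)) (t u : R).

Lemma htd_slice S t1 t2 t j : hybrid_time_domain S ->
  S (t1, j) -> S (t2, j) -> t1 <= t <= t2 -> S (t, j).
Proof.
move=> [pos htd] S1 S2 /andP[tt1 tt2].
have [J [c [_ _ /seteqP[E1 E2]]]] := htd _ _ S2.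
have := pos _ S1; have := pos _ S2; rewrite /= => p2 p1.
have /E1 [/= jJ /andP[c1 _]] : (S `&` (`[0, t2] `*` [set j' | (j' <= j)%N])) (t1, j).
  by split=> //; split=> //=; rewrite in_itv /=; apply/andP; split; lra.
have /E1 [/= _ /andP[_ c2]] : (S `&` (`[0, t2] `*` [set j' | (j' <= j)%N])) (t2, j).
  by split=> //; split=> //=; rewrite in_itv /= lexx andbT.
have [] // : (S `&` (`[0, t2] `*` [set j' | (j' <= j)%N])) (t, j).
by apply: E2; split=> //=; rewrite (le_trans c1) // (le_trans tt2).
Qed.

Lemma htd_jump S t j : hybrid_time_domain S -> S (t, j.+1) ->
  exists u, S (u, j) /\ S (u, j.+1).
Proof.
move=> [pos htd] St; have [J [c [c0 mono /seteqP[E1 E2]]]] := htd _ _ St.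
have t0 := pos _ St; rewrite /= in t0.
have /E1 [/= jJ _] : (S `&` (`[0, t] `*` [set j' | (j' <= j.+1)%N])) (t, j.+1).
  by split=> //; split=> //=; rewrite in_itv /= t0 lexx.
exists (c j.+1); split.
- have [] // : (S `&` (`[0, t] `*` [set j' | (j' <= j.+1)%N])) (c j.+1, j).
  by apply: E2; split=> /=; [exact: ltnW | rewrite lexx andbT mono // ltnW].
- have [] // : (S `&` (`[0, t] `*` [set j' | (j' <= j.+1)%N])) (c j.+1, j.+1).
  by apply: E2; split=> //=; rewrite lexx mono.
Qed.

(** As only truncations are constrained, level j may last beyond some times of
level j + 1; but a time at which both levels are present bounds level j + 1
from below. *)
Lemma htd_jump_min S u t j : hybrid_time_domain S ->
  S (u, j) -> S (u, j.+1) -> S (t, j.+1) -> u <= t.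
Proof.
move=> [pos htd] Su Su1 St; have [//|tu] := leP u t.
have [J [c [c0 mono /seteqP[E1 _]]]] := htd _ _ Su1.
have := pos _ Su; have := pos _ St => /= t0 u0.
have /E1 [/= _ /andP[_ c1]] : (S `&` (`[0, u] `*` [set j' | (j' <= j.+1)%N])) (u, j).
  by split=> //; split=> //=; rewrite in_itv /= u0 lexx.
have /E1 [/= _ /andP[c2 _]] : (S `&` (`[0, u] `*` [set j' | (j' <= j.+1)%N])) (t, j.+1).
  by split=> //; split=> //=; rewrite in_itv /= t0 ltW.
by move: (le_lt_trans (le_trans c1 c2) tu); rewrite ltxx.
Qed.

End time_domains.

(** * Solutions and explicit trajectories of the oscillators *)

Section oscillator_solutions.
Context {R : realType} (N : nat) (T om eps : R).
Hypothesis om_gt0 : 0 < om.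
Local Notation H := (oscillators N T om eps).
Implicit Types (x : hybrid_fun R N) (tau : 'cV[R]_N).

Lemma solution_flow x t1 t2 j : solution H x ->
  hdom x (t1, j) -> hdom x (t2, j) -> t1 <= t2 ->
  hval x t2 j = hval x t1 j + const_mx (om * (t2 - t1)).
Proof.
move=> [[htd ac] _ fl _] d1 d2 t12.
rewrite (@ac_derive_const _ _ t1 t2 (fun t => hval x t j) (const_mx om)) //.
- by congr (_ + _); apply/colP => i; rewrite !mxE mulrC.
- by apply: ac => t /=; rewrite in_itv /=; exact: htd_slice d1 d2.
- apply: negligibleS (fl j) => t /= + fl'; apply => t12'.
  by have [] := fl' (htd_slice htd d1 d2 t12').
Qed.

(** The flow set only constrains almost every time, but the flow is affine by
[solution_flow] and the cube is closed. *)
Lemma solution_flow_cube x t1 t2 j : solution H x ->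
  hdom x (t1, j) -> hdom x (t2, j) -> t1 < t2 ->
  cube N T (hval x t1 j) /\ cube N T (hval x t2 j).
Proof.
move=> sx d1 d2 t12; have [[htd ac] _ fl _] := sx.
have val t i : t1 <= t <= t2 -> hval x t j i 0 = hval x t1 j i 0 + om * (t - t1).
  move=> tt; rewrite (solution_flow sx d1 (htd_slice htd d1 d2 tt)) ?add_constE //.
  by case/andP: tt.
have dense u v : t1 <= u -> v <= t2 -> u < v -> exists2 t, u < t < v & cube N T (hval x t j).
  move=> tu vt uv; have [t ut Ht] := ae_exists_between (fl j) uv.
  exists t => //; have [] // := Ht (htd_slice htd d1 d2 _).
  by apply/andP; split; lra.
have [t ut ct] := dense _ _ (lexx _) (lexx _) t12.
have lo i : 0 <= hval x t1 j i 0.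
  rewrite leNgt; apply/negP => neg.
  have e0 : 0 < - hval x t1 j i 0 / om by rewrite divr_gt0 ?oppr_gt0.
  have [| |v vt cv] := dense t1 (Num.min t2 (t1 + - hval x t1 j i 0 / om)) (lexx _).
  - by rewrite ge_min lexx.
  - by rewrite lt_min t12; lra.
  move: vt; rewrite lt_min => /and3P[v1 v2 v3].
  have := cv i; rewrite val; last by apply/andP; split; lra.
  have : v - t1 < - hval x t1 j i 0 / om by lra.
  by rewrite ltr_pdivlMr // mulrC; lra.
have hi i : hval x t2 j i 0 <= T.
  rewrite leNgt; apply/negP => big.
  have e0 : 0 < (hval x t2 j i 0 - T) / om by rewrite divr_gt0 ?subr_gt0.
  have [| |v vt cv] := dense (Num.max t1 (t2 - (hval x t2 j i 0 - T) / om)) t2 _ (lexx _).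
  - by rewrite le_max lexx.
  - by rewrite gt_max t12; lra.
  move: vt; rewrite gt_max => /andP[/andP[v1 v2] v3].
  have := cv i; rewrite val; last by apply/andP; split; lra.
  have : t2 - v < (hval x t2 j i 0 - T) / om by lra.
  rewrite ltr_pdivlMr // mulrC (val t2); last by apply/andP; split; lra.
  by lra.
have up : 0 <= om * (t2 - t1) by rewrite mulr_ge0 ?(ltW om_gt0) ?subr_ge0 ?(ltW t12).
split=> i; rewrite ?lo ?hi ?andbT /=.
  by have := hi i; rewrite val; [lra | apply/andP; split; lra].
by rewrite val; [have := lo i; lra | apply/andP; split; lra].
Qed.

Definition clock (d : nat -> R) j : R := \sum_(i < j) d i.

Definition flow_end (q : nat -> 'cV[R]_N) (d : nat -> R) j : 'cV[R]_N :=
  q j + const_mx (om * d j).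

Definition trajectory (q : nat -> 'cV[R]_N) (d : nat -> R) : hybrid_fun R N :=
  {| hdom := [set z | clock d z.2 <= z.1 <= clock d z.2.+1];
     hval := fun t j => q j + const_mx (om * (t - clock d j)) |}.

(** The data of a solution that jumps as soon as it reaches the jump set: [q j] is
the state after j jumps and [d j] the time spent flowing from it. *)
Definition is_run (q : nat -> 'cV[R]_N) (d : nat -> R) : Prop :=
  forall j, [/\ 0 <= d j, cube N T (q j), osc_jump_set T (flow_end q d j) &
                osc_jump_map T eps (flow_end q d j) (q j.+1)].

Section run.
Variables (q : nat -> 'cV[R]_N) (d : nat -> R).
Hypothesis run : is_run q d.
Local Notation traj := (trajectory q d).

Lemma clockS j : clock d j.+1 = clock d j + d j.
Proof. by rewrite /clock big_ord_recr. Qed.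

Lemma clock0 : clock d 0 = 0.
Proof. by rewrite /clock big_ord0. Qed.

Lemma dwell_ge0 j : 0 <= d j.
Proof. by have [] := run j. Qed.

Lemma clock_mono : {homo clock d : i j / (i <= j)%N >-> i <= j}.
Proof.
apply: homo_leq => [i|j i k|i]; [exact: lexx | exact: le_trans |].
by rewrite clockS lerDl dwell_ge0.
Qed.

Lemma clock_ge0 j : 0 <= clock d j.
Proof. by rewrite -clock0 clock_mono. Qed.

Lemma trajectory_start j : hdom traj (clock d j, j) /\ hval traj (clock d j) j = q j.
Proof.
split; first by rewrite /= lexx clock_mono.
by rewrite /= subrr mulr0; apply/colP => i; rewrite !mxE addr0.
Qed.

Lemma trajectory_end j :
  [/\ hdom traj (clock d j.+1, j), hdom traj (clock d j.+1, j.+1) &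
      hval traj (clock d j.+1) j = flow_end q d j].
Proof.
split; [by rewrite /= lexx clock_mono | by case: (trajectory_start j.+1) |].
by rewrite /= /flow_end clockS addrAC subrr add0r.
Qed.

Lemma flow_end_hit j : exists i, q j i 0 + om * d j = T.
Proof.
have [_ _ [_ [i Ei]] _] := run j.
by exists i; rewrite -[RHS]Ei /flow_end add_constE.
Qed.

Lemma trajectory_cube t j : hdom traj (t, j) -> cube N T (hval traj t j).
Proof.
rewrite /= clockS => /andP[tj jt] i; have [_ /(_ i) c1 [/(_ i) c2 _] _] := run j.
move: c2; rewrite /flow_end !add_constE => c2.
have : 0 <= om * (t - clock d j) by rewrite mulr_ge0 ?(ltW om_gt0) ?subr_ge0.
have : om * (t - clock d j) <= om * d j by rewrite ler_wpM2l ?(ltW om_gt0) //; lra.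
by move=> ? ?; apply/andP; split; lra.
Qed.

Lemma trajectory_htd : hybrid_time_domain (hdom traj).
Proof.
split=> [[t j] /= /andP[+ _]|t J /= /andP[tJ Jt]]; first exact/le_trans/clock_ge0.
exists J.+1, (fun j => if (j <= J)%N then clock d j else t); split.
- by rewrite clock0.
- move=> j; rewrite ltnS => jJ; rewrite jJ; case: ifP => // jJ'; first exact: clock_mono.
  by have -> : j = J by lia.
apply/seteqP; split=> -[u j] /=.
  move=> [/andP[uj ju] [/=]]; rewrite in_itv /= => /andP[u0 ut] jJ.
  by rewrite ltnS jJ uj; split=> //; case: ifP.
rewrite ltnS => -[jJ]; rewrite jJ => /andP[uj]; case: ifP => jJ'.
  move=> ju; split; first by rewrite uj.
  split=> //=; rewrite in_itv /= (le_trans (clock_ge0 j)) //=.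
  by apply: le_trans ju (le_trans _ tJ); exact: clock_mono.
have -> : j = J by lia.
move=> ut; split; first by rewrite (le_trans ut Jt) andbT; have <- : j = J by lia.
split=> //=; rewrite in_itv /= ut andbT.
exact: le_trans (clock_ge0 j) uj.
Qed.

Lemma trajectory_derive (t : R) (j : nat) :
  is_derive t 1 (fun s : R => hval traj s j) (const_mx om).
Proof.
pose f (s : R) : 'cV[R]_N := q j + const_mx (om * (s - clock d j)).
have quot h : h != 0 -> h^-1 *: (f (h + t) - f t) = const_mx om.
  move=> h0; apply/colP => i; rewrite !mxE; move: (q j i 0) (clock d j) => x c.
  by field.
have C : h^-1 *: ((f \o shift t) (h *: 1) - f t) @[h --> 0^'] --> (const_mx om : 'cV[R]_N).
  apply: cvg_near_cst; near=> h; rewrite -(quot h).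
    by rewrite /shift /= [h *: 1]mulr1.
  by near: h; exact: nbhs_dnbhs_neq.
by split; [apply: cvgP C | apply: cvg_lim C].
Unshelve. all: by end_near.
Qed.

(** The flow is Lipschitz, with constant at most N * om. *)
Lemma trajectory_ac j a b : abs_continuous a b (fun t => hval traj t j).
Proof.
move=> e e0; have K0 : 0 < N%:R * om + 1 by rewrite ltr_wpDl // mulr_ge0 // ltW.
exists (e / (N%:R * om + 1)); first exact: divr_gt0.
move=> m u v uv _; rewrite ltr_pdivlMr // => lt.
apply: le_lt_trans lt; rewrite mulr_suml; apply: ler_sum => k _.
have [_ [uvk _]] := uv k; have vu : 0 <= v k - u k by rewrite subr_ge0.
have vu' : 0 <= om * (v k - u k) by rewrite mulr_ge0 // ltW.
apply: (@le_trans _ _ (N%:R * (om * (v k - u k)))).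
  apply: enorm_le => // i; rewrite !mxE.
  by rewrite [X in `|X|](_ : _ = om * (v k - u k)) ?ger0_norm //; ring.
by rewrite mulrA mulrC ler_wpM2l //; lra.
Qed.

Lemma trajectory_solution : solution H traj.
Proof.
split.
- split; first exact: trajectory_htd.
  by move=> j a b _; exact: trajectory_ac.
- split; first by rewrite -clock0; case: (trajectory_start 0).
  have := proj2 (trajectory_start 0); rewrite clock0 => ->.
  by left; have [] := run 0.
- move=> j; apply: aeW => t tj; split; [exact: trajectory_cube | exact: trajectory_derive].
- move=> t j /= /andP[_ t1] /andP[t2 _].
  have -> : t = clock d j.+1 by apply/eqP; rewrite eq_le t1 t2.
  have [_ _ E] := trajectory_end j; rewrite /= in E; rewrite E.
  have [_ E'] := trajectory_start j.+1; rewrite /= in E'; rewrite E'.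
  by have [] := run j.
Qed.

Lemma trajectory_complete : complete_arc traj.
Proof.
move=> [M HM]; pose j := Num.bound `|M|.
have Mj : `|M| < j%:R by apply: archi_boundP.
have := HM _ _ (proj1 (trajectory_start j)); have := clock_ge0 j.
by have := ler_norm M; lra.
Qed.

(** At time [clock d j.+1] some phase is equal to [T]; flowing further would leave
the cube. *)
Lemma solution_flow_le x t j : solution H x -> hdom x (clock d j, j) ->
  hval x (clock d j) j = q j -> hdom x (t, j) -> t <= clock d j.+1.
Proof.
move=> sx d1 v1 d2; rewrite leNgt; apply/negP; rewrite clockS => lt.
have dj := dwell_ge0 j.
have [|_ c2] := solution_flow_cube sx d1 d2; first by lra.
have [i Ei] := flow_end_hit j; have := c2 i.
rewrite (solution_flow sx d1 d2); last by lra.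
rewrite v1 add_constE => /andP[_].
have : om * d j < om * (t - clock d j) by rewrite ltr_pM2l //; lra.
by lra.
Qed.

(** An extension cannot add a time after the end of a level, by
[solution_flow_le], nor before its start, by [htd_jump_min]; and all levels are
already present. *)
Lemma trajectory_maximal : maximal_solution H traj.
Proof.
split; first exact: trajectory_solution.
move=> [y [sy [[sub nsub] Ey]]]; apply: nsub => -[t j] yt.
have [[htd _] _ _ _] := sy.
have [sd sv] := trajectory_start j.
apply/andP; split=> /=; last first.
  by apply: (solution_flow_le sy (sub _ sd)) => //; rewrite -Ey.
case: j yt sd sv => [|j] yt sd sv; first by rewrite clock0; have := proj1 htd _ yt.
have [e1 e2 _] := trajectory_end j.
exact: htd_jump_min htd (sub _ e1) (sub _ e2) yt.
Qed.

Section unique_jumps.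
Hypothesis jump_uniq : forall j tau,
  osc_jump_map T eps (flow_end q d j) tau -> tau = q j.+1.

(** By induction on the number of jumps: a solution can only jump when it meets
the jump set, which happens exactly at the end of the flow of the run. *)
Lemma solution_sub_trajectory x t j : solution H x -> hval x 0 0 = q 0 ->
  hdom x (t, j) -> hdom traj (t, j) /\ hval x t j = hval traj t j.
Proof.
move=> sx x0; have [[htd _] [d0 _] _ jp] := sx.
have level k u : hdom x (clock d k, k) -> hval x (clock d k) k = q k ->
    clock d k <= u -> hdom x (u, k) -> hdom traj (u, k) /\ hval x u k = hval traj u k.
  move=> d1 v1 ku d2; split.
    by rewrite /= ku (solution_flow_le sx d1).
  by rewrite (solution_flow sx d1 d2 ku) v1.
elim: j t => [|j IH] t dt.
  by apply: level; rewrite ?clock0 //; have := proj1 htd _ dt.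
have [u [du du1]] := htd_jump htd dt.
have [/= /andP[u1 u2] Eu] := IH _ du.
have [D G] := jp _ _ du du1.
have uE : u = clock d j.+1.
  apply/eqP; rewrite eq_le u2 /= clockS.
  have [_ [i]] := D; rewrite Eu add_constE => Ei.
  have [_ _ [/(_ i) + _] _] := run j; rewrite /flow_end add_constE.
  move=> /andP[_ ci]; have : om * d j <= om * (u - clock d j) by lra.
  by rewrite ler_pM2l //; lra.
apply: level.
- by rewrite -uE.
- rewrite -uE; apply: jump_uniq; rewrite /= in G.
  by have [_ _ <-] := trajectory_end j; rewrite -uE -[X in osc_jump_map _ _ X]Eu.
- by rewrite -uE; apply: htd_jump_min htd du du1 dt.
- by [].
Qed.

Lemma maximal_trajectory x : maximal_solution H x -> hval x 0 0 = q 0 ->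
  forall t j, hdom x (t, j) <-> hdom traj (t, j).
Proof.
move=> [sx mx] x0 t j; split; first by move=> /(solution_sub_trajectory sx x0)[].
apply: contraPP => nx tj; apply: mx; exists traj; split; first exact: trajectory_solution.
split; last by move=> u k /(solution_sub_trajectory sx x0)[].
split; first by move=> [u k] /(solution_sub_trajectory sx x0)[].
by move=> /(_ (t, j)); apply: contra_not nx; apply.
Qed.

End unique_jumps.
End run.
End oscillator_solutions.

(** * Dynamics of the cyclic gaps *)

Section gaps.
Context {R : realType} (n : nat) (T eps : R).
Hypotheses (n_gt0 : (0 < n)%N) (T_gt0 : 0 < T) (eps_itv : -1 < eps < 0).
Local Notation a := (1 + eps).
Implicit Types (s : 'S_n.+1) (tau : 'cV[R]_n.+1).

Lemma ratio_itv : 0 < a < 1.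
Proof. by case/andP: eps_itv => *; apply/andP; split; lra. Qed.

(** The cyclic gap after the k-th highest oscillator, when [s] lists the
oscillators by decreasing phase. For the last one, [ordS] wraps around to the
highest and the added [T] is the length of the circle. *)
Definition gap s tau (k : 'I_n.+1) : R :=
  tau (s k) 0 - tau (s (ordS k)) 0 + (k == ord_max)%:R * T.

Definition last_gap : R := T / \sum_(i < n.+1) a ^+ i.

(** These are the gaps of [desync_pt], see [gap_desync_line]. *)
Definition ideal_gap (k : 'I_n.+1) : R := a ^+ (n - k) * last_gap.

(** The order after a jump: the highest oscillator becomes the lowest. *)
Definition rot_perm s : 'S_n.+1 := (perm (@ordS_inj n.+1) * s)%g.

Definition reset_top s tau : 'cV[R]_n.+1 :=
  \col_i (if i == s ord0 then 0 else a * tau i 0).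

Definition gap_close (w : R) s tau : Prop :=
  forall k, `|gap s tau k - ideal_gap k| <= w.

Lemma ordS_max : ordS (ord_max : 'I_n.+1) = ord0.
Proof. by apply: val_inj; rewrite /= modnn. Qed.

Lemma ordS_lt (k : 'I_n.+1) : k != ord_max -> ordS k = k.+1 :> nat.
Proof.
rewrite -val_eqE /= => kn; rewrite modn_small //.
by have := ltn_ord k; lia.
Qed.

Lemma ordS_eq0 (k : 'I_n.+1) : (ordS k == ord0) = (k == ord_max).
Proof. by rewrite -ordS_max (inj_eq (@ordS_inj _)). Qed.

Lemma sum_pow_gt0 m : 0 < \sum_(i < m.+1) a ^+ i.
Proof.
case/andP: ratio_itv => a0 _.
rewrite big_ord_recl expr0 ltr_pwDl // sumr_ge0 // => i _.
by rewrite exprn_ge0 // ltW.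
Qed.

Lemma last_gap_gt0 : 0 < last_gap.
Proof. by rewrite divr_gt0 // sum_pow_gt0. Qed.

Local Notation min_gap := (a ^+ n * last_gap).

Lemma min_gap_gt0 : 0 < min_gap.
Proof.
have /andP[a0 _] := ratio_itv.
by rewrite mulr_gt0 ?exprn_gt0 ?last_gap_gt0.
Qed.

Lemma last_gap_sum : last_gap * (\sum_(i < n.+1) a ^+ i) = T.
Proof. by rewrite mulfVK // gt_eqF // sum_pow_gt0. Qed.

Lemma ideal_gap_ge k : min_gap <= ideal_gap k.
Proof.
case/andP: ratio_itv => a0 a1; rewrite ler_wpM2r ?(ltW last_gap_gt0) //.
by rewrite ler_wiXn2l ?leq_subr // ltW.
Qed.

Lemma gap_flow s tau c k : gap s (tau + const_mx c) k = gap s tau k.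
Proof. by rewrite /gap !mxE; ring. Qed.

(** The permutation is rotated along with the jump; the oscillator that moves to 0
loses [T] before scaling, which the wrap-around term absorbs. *)
Lemma gap_reset_top s tau k : tau (s ord0) 0 = T ->
  gap (rot_perm s) (reset_top s tau) k =
  a * gap s tau (ordS k) + (k == ord_max)%:R * ((1 - a) * T).
Proof.
move=> top; have E j : reset_top s tau (s j) 0 =
    a * tau (s j) 0 - (j == ord0)%:R * (a * T).
  rewrite mxE (inj_eq perm_inj); case: eqVneq => [->|_] /=; last by ring.
  by rewrite top; ring.
rewrite /gap !permM !permE !E !ordS_eq0; ring.
Qed.

(** The ideal gaps are the fixed point of the affine map of [gap_reset_top]; at the
last index this is the sum of the geometric series. *)
Lemma ideal_gap_fix k :
  ideal_gap k = a * ideal_gap (ordS k) + (k == ord_max)%:R * ((1 - a) * T).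
Proof.
rewrite /ideal_gap; have [->|kmax] := eqVneq k ord_max.
  rewrite ordS_max /= subn0 subnn expr0 !mul1r -[X in (1 - a) * X]last_gap_sum.
  rewrite [(1 - a) * _]mulrCA -[1 - a]opprB mulNr -subrX1 exprS; ring.
rewrite mul0r addr0 mulrA -exprS ordS_lt //; congr (a ^+ _ * _).
by move: kmax (ltn_ord k); rewrite -val_eqE /=; lia.
Qed.

Lemma gap_close_flow w s tau c :
  gap_close w s tau -> gap_close w s (tau + const_mx c).
Proof. by move=> H k; rewrite gap_flow. Qed.

(** The affine map on gaps is a shift followed by a scaling by 1 + eps, an exact
contraction in the sup distance. *)
Lemma gap_close_reset_top w s tau : tau (s ord0) 0 = T ->
  gap_close w s tau -> gap_close (a * w) (rot_perm s) (reset_top s tau).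
Proof.
case/andP: ratio_itv => a0 _ top H k; rewrite gap_reset_top // ideal_gap_fix.
rewrite [X in `|X|](_ : _ = a * (gap s tau (ordS k) - ideal_gap (ordS k))).
  rewrite normrM (gtr0_norm a0).
  by rewrite ler_wpM2l // ltW.
by ring.
Qed.

Lemma gap_lt s tau (k : nat) : (k < n)%N -> gap s tau (inord k) =
  tau (s (inord k)) 0 - tau (s (inord k.+1)) 0.
Proof.
move=> kn; have kmax : (inord k : 'I_n.+1) != ord_max.
  by rewrite -val_eqE /= inordK; lia.
rewrite /gap (negbTE kmax) mul0r addr0; congr (_ - tau (s _) 0).
by apply: val_inj; rewrite /= inordK ?modn_small ?inordK //; lia.
Qed.

Lemma gap_max s tau :
  gap s tau ord_max = tau (s ord_max) 0 - tau (s ord0) 0 + T.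
Proof. by rewrite /gap eqxx mul1r ordS_max. Qed.

Lemma gap_ge0_mono s tau : (forall k, 0 <= gap s tau k) ->
  forall i j : 'I_n.+1, (i <= j)%N -> tau (s j) 0 <= tau (s i) 0.
Proof.
move=> H i j ij.
suff G m k : (k + m <= n)%N -> tau (s (inord (k + m))) 0 <= tau (s (inord k)) 0.
  have := G (j - i)%N i; rewrite subnKC // !inord_val; apply.
  by have := ltn_ord j; lia.
elim: m => [|m IH] km; first by rewrite addn0.
apply: le_trans (IH _); last by lia.
rewrite addnS; have := H (inord (k + m)); rewrite gap_lt; last by lia.
by rewrite subr_ge0.
Qed.

Lemma gap_gt0_mono s tau : (forall k, 0 < gap s tau k) ->
  forall i j : 'I_n.+1, (i < j)%N -> tau (s j) 0 < tau (s i) 0.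
Proof.
move=> H i j ij; have jn := ltn_ord j.
have : 0 < gap s tau i by [].
rewrite -[i]inord_val gap_lt; last by lia.
rewrite subr_gt0 => /(le_lt_trans _); apply.
apply: gap_ge0_mono => [k|]; first by rewrite ltW.
by rewrite inordK; lia.
Qed.

(** In closed form, the linear system says that successive differences have ratio
1 + eps, see [desync_pt_uniq]. *)
Lemma desync_ptE (k : 'I_n.+1) :
  desync_pt n.+1 T eps k 0 = last_gap * \sum_(i < n.+1 - k) a ^+ i.
Proof.
pose P m := last_gap * \sum_(i < n.+1 - m) a ^+ i.
pose p : 'cV[R]_n.+1 := \col_i P i.
suff <- : p = desync_pt n.+1 T eps by rewrite mxE.
apply: desync_pt_uniq => //; apply/colP => i; rewrite !mxE.
have PN : P n.+1 = 0 by rewrite /P subnn big_ord0 mulr0.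
have P0 : P 0%N = T by rewrite /P subn0 last_gap_sum.
have PS m : (m <= n)%N -> P m = last_gap + a * P m.+1.
  move=> mn; rewrite /P subSn // subSS big_ord_recl expr0 mulrDr mulr1.
  congr (_ + _); rewrite mulrCA; congr (_ * _); rewrite mulr_sumr.
  by apply: eq_bigr => j _; rewrite -exprS.
have sel m : (m <= n.+1)%N -> \sum_(j < n.+1) (j == m :> nat)%:R * P j = P m.
  rewrite leq_eqVlt => /orP[/eqP->|mn].
    by rewrite PN big1 // => j _; rewrite (ltn_eqF (ltn_ord j)) mul0r.
  rewrite (bigD1 (Ordinal mn)) //= eqxx mul1r big1 ?addr0 // => j.
  by rewrite -val_eqE /= => /negbTE ->; rewrite mul0r.
case: i => [[|[|i]] iN] /=.
- rewrite -[RHS]P0 -(sel 0%N) //; apply: eq_bigr => j _; rewrite !mxE /=.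
  by [].
- transitivity ((2 + eps) * P 1%N - a * P 2%N).
    rewrite -(sel 1%N) // -(sel 2%N) // !mulr_sumr -sumrB.
    apply: eq_bigr => j _; rewrite !mxE /=.
    by case: eqVneq => [->|_] /=; [|case: eqVneq => _ /=]; ring.
  have E1 := PS _ (leq0n n); have E2 := PS _ n_gt0.
  by rewrite -P0 E1 mulrDl; lra.
- transitivity (a * P 1%N + P i.+2 - a * P i.+3).
    rewrite -(sel 1%N) // -(sel i.+2) 1?ltnW // -(sel i.+3) //.
    rewrite !mulr_sumr -big_split /= -sumrB.
    apply: eq_bigr => j _; rewrite !mxE /= -val_eqE /=.
    case: (eqVneq (nat_of_ord j) 1%N) => [->|_] /=; first by ring.
    case: (eqVneq (nat_of_ord j) i.+2) => [->|_] /=.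
      by rewrite (ltn_eqF (ltnSn _)) /=; ring.
    by case: eqVneq => _ /=; ring.
  by rewrite (PS i.+2) // -P0 (PS 0%N) //; ring.
Qed.

Local Notation p := (desync_pt n.+1 T eps).
Local Notation A := (desync_set n.+1 T eps).

Lemma desync_pt0 : p ord0 0 = T.
Proof. by rewrite desync_ptE subn0 last_gap_sum. Qed.

Lemma desync_pt_max : p ord_max 0 = last_gap.
Proof. by rewrite desync_ptE /= subSnn big_ord1 expr0 mulr1. Qed.

(** * Gaps and distance to the desynchronization set *)

Lemma sub_colE tau tau' i : (tau - tau') i 0 = tau i 0 - tau' i 0.
Proof. by rewrite mxE [X in _ + X]mxE. Qed.

Lemma row_perm_colE s tau i : row_perm s tau i 0 = tau (s i) 0.
Proof. by rewrite mxE. Qed.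

Let entryE := (sub_colE, @add_constE R n.+1, row_perm_colE).

Lemma gap_desync_line s c k :
  gap s (row_perm s^-1 p + const_mx c) k = ideal_gap k.
Proof.
rewrite gap_flow /gap !entryE !permK.
have [->|kmax] := eqVneq k ord_max.
  rewrite ordS_max desync_pt0 desync_pt_max /ideal_gap subnn expr0 /=; ring.
rewrite !desync_ptE ordS_lt // mul0r addr0 -mulrBr /ideal_gap mulrC.
have kn : (k < n)%N by move: kmax (ltn_ord k); rewrite -val_eqE /=; lia.
rewrite subSS subSn 1?ltnW // big_ord_recr /=.
by rewrite addrAC subrr add0r.
Qed.

Lemma edist_le (B : set 'cV[R]_n.+1) z tau : B z -> edist B tau <= enorm (tau - z).
Proof.
move=> Bz; apply: ge_inf; last by exists z.
by exists 0 => _ [y _ <-]; apply: sqrtr_ge0.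
Qed.

Lemma edist_lt (B : set 'cV[R]_n.+1) tau d : B !=set0 -> edist B tau < d ->
  exists2 z, B z & enorm (tau - z) < d.
Proof.
move=> [z0 Bz0] H.
have hi : has_inf [set enorm (tau - z) | z in B].
  split; first by exists (enorm (tau - z0)); exists z0.
  by exists 0 => _ [y _ <-]; apply: sqrtr_ge0.
have d0 : 0 < d - edist B tau by rewrite subr_gt0.
have [_ [z Bz <-]] := inf_adherent d0 hi.
by rewrite -/(edist B tau) => zd; exists z => //; lra.
Qed.

(** The difference of [tau] and the ideal configuration varies by at most [w]
between consecutive oscillators; telescope from the highest one. *)
Lemma close_entries w s tau (k : 'I_n.+1) : gap_close w s tau ->
  `|(tau - row_perm s^-1 p) (s k) 0 - (tau - row_perm s^-1 p) (s ord0) 0| <=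
    k%:R * w.
Proof.
move=> H; rewrite -[X in s X](inord_val k); set q := tau - _.
have Hq j : (j < n)%N -> `|q (s (inord j.+1)) 0 - q (s (inord j)) 0| <= w.
  move=> jn; have := H (inord j).
  rewrite -(gap_desync_line s 0) !gap_lt // distrC; congr (`|_| <= _).
  by rewrite /q !entryE; ring.
have := ltn_ord k; rewrite ltnS; elim: (k : nat) => [|j IH] jn.
  by rewrite (_ : inord 0 = ord0) ?subrr ?normr0 ?mul0r //; apply: val_inj; rewrite /= inordK.
rewrite -natr1 mulrDl mul1r [leRHS]addrC.
have -> : q (s (inord j.+1)) 0 - q (s ord0) 0 =
  (q (s (inord j.+1)) 0 - q (s (inord j)) 0) + (q (s (inord j)) 0 - q (s ord0) 0) by ring.
by apply: le_trans (ler_normD _ _) _; apply: lerD; [exact: Hq | apply: IH; lia].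
Qed.

Lemma desync_pt_itv i : last_gap <= p i 0 <= T.
Proof.
have L0 := ltW last_gap_gt0; have [/ltW a0 _] := andP ratio_itv.
have mono m1 m2 : (m1 <= m2)%N -> \sum_(j < m1) a ^+ j <= \sum_(j < m2) a ^+ j.
  move=> m12; rewrite -(subnKC m12) big_split_ord /= lerDl.
  by apply: sumr_ge0 => j _; apply: exprn_ge0.
have iN := ltn_ord i.
apply/andP; split; [rewrite -[leLHS]desync_pt_max | rewrite -[leRHS]desync_pt0].
  by rewrite !desync_ptE ler_wpM2l // mono //=; lia.
by rewrite !desync_ptE ler_wpM2l // mono //=; lia.
Qed.

(** The highest phase of [desync_pt] is [T] and the lowest [last_gap], which gives
the shifts that stay in the cube. *)
Lemma desync_lineE (s : 'S_n.+1) :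
  desync_line T eps s = (fun c : R => row_perm s p + const_mx c) @` `[- last_gap, 0].
Proof.
apply/seteqP; split=> tau.
  move=> [ctau [c E]]; exists c => //=; rewrite in_itv /=.
  have := ctau (s^-1 ord0)%g; have := ctau (s^-1 ord_max)%g.
  by rewrite E !entryE !permKV desync_pt0 desync_pt_max; lra.
move=> [c /=]; rewrite in_itv /= => cL <-; split; last by exists c.
by move=> i; rewrite !entryE; have := desync_pt_itv (s i); lra.
Qed.

Lemma desync_set_neq0 : A !=set0.
Proof.
exists (row_perm 1 p + const_mx 0); exists 1%g => //; rewrite desync_lineE.
by exists 0 => //=; rewrite in_itv /= lexx andbT oppr_le0 ltW ?last_gap_gt0.
Qed.

Lemma desync_set_compact : compact A.
Proof.
rewrite /desync_set (_ : \bigcup_s _ =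
  \big[setU/set0]_(s <- enum 'S_n.+1) desync_line T eps s); last first.
  rewrite -bigcup_seq; congr (bigcup _ _); apply/seteqP; split=> // s _ /=.
  by rewrite mem_enum.
apply: bigsetU_compact => s _; rewrite desync_lineE.
apply: continuous_compact; last exact: segment_compact.
apply: continuous_subspaceT => c; apply: cvgD; first exact: cvg_cst.
have E : (fun x : R => x *: (const_mx 1 : 'cV[R]_n.+1)) = const_mx.
  by apply/funext => x; apply/matrixP => i j; rewrite !mxE mulr1.
by rewrite -E; apply: cvgZr_tmp; exact: cvg_id.
Qed.

(** Compare with the point of the line that has the same highest phase, up to
clamping the shift to the segment of [desync_lineE]. Clamping costs at most
[w] because the lowest phase of [tau] is nonnegative. Each of the n + 1 phases
is then off by at most n * w from [close_entries], plus [w]. *)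
Lemma edist_le_gap_close w s tau : cube n.+1 T tau -> gap_close w s tau ->
  edist A tau <= (n.+1 * n.+1)%:R * w.
Proof.
move=> ct H; have w0 : 0 <= w by apply: le_trans (H ord0).
have L0 := last_gap_gt0.
(* The shift that matches the highest phase, clamped from below. *)
pose c := Num.max (tau (s ord0) 0 - T) (- last_gap).
have c0 : c <= 0.
  by have := ct (s ord0); rewrite ge_max => ?; apply/andP; split; lra.
have cL : - last_gap <= c by rewrite le_max lexx orbT.
have cw : `|tau (s ord0) 0 - T - c| <= w.
  have := H ord_max; rewrite gap_max /ideal_gap subnn expr0 mul1r ler_distl.
  move=> /andP[_]; have := ct (s ord_max); rewrite /c maxEle; case: ifP => cE.
    by rewrite ler_norml => ? ?; apply/andP; split; lra.
  by move=> _ _; rewrite subrr normr0.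
have Az : A (row_perm s^-1 p + const_mx c).
  by exists (s^-1)%g => //; rewrite desync_lineE; exists c => //=; rewrite in_itv /= cL.
apply: le_trans (edist_le _ Az) _; rewrite natrM -mulrA.
apply: enorm_le; first by rewrite mulr_ge0.
move=> i; rewrite -(permKV s i); set k := (s^-1)%g i.
have -> : (tau - (row_perm s^-1 p + const_mx c)) (s k) 0 =
   ((tau - row_perm s^-1 p) (s k) 0 - (tau - row_perm s^-1 p) (s ord0) 0)
   + (tau (s ord0) 0 - T - c).
  by rewrite !entryE !permK desync_pt0; ring.
rewrite -natr1 mulrDl mul1r; apply: le_trans (ler_normD _ _) _; apply: lerD => //.
apply: le_trans (close_entries k H) _; rewrite ler_wpM2r // ler_nat -ltnS.
exact: ltn_ord.
Qed.

(** A gap is a difference of two phases, each known up to [d]. *)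
Lemma edist_lt_gap_close d tau : edist A tau < d -> exists s, gap_close (2 * d) s tau.
Proof.
move=> /(edist_lt desync_set_neq0) [_ [s _ [_ [c ->]]] H]; exists (s^-1)%g => k.
rewrite -(gap_desync_line (s^-1)%g c) invgK; set z := row_perm s p + _ in H *.
have Hi i : `|tau i 0 - z i 0| <= d.
  apply: le_trans (ltW H); apply: le_trans (entry_le_enorm _ i).
  by rewrite sub_colE.
rewrite [X in `|X|](_ : _ = (tau ((s^-1)%g k) 0 - z ((s^-1)%g k) 0) -
  (tau ((s^-1)%g (ordS k)) 0 - z ((s^-1)%g (ordS k)) 0)); last by rewrite /gap; ring.
by apply: le_trans (ler_normB _ _) _; rewrite mulr_natl mulr2n lerD.
Qed.

(** Positivity of the last gap excludes a phase at 0 together with one at [T]. *)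
Definition well_spaced s tau : Prop :=
  cube n.+1 T tau /\ forall k, 0 < gap s tau k.

Lemma gap_close_well_spaced w s tau : cube n.+1 T tau ->
  w < min_gap -> gap_close w s tau -> well_spaced s tau.
Proof.
move=> ct wL H; split=> // k; have := H k; rewrite ler_distl => /andP[+ _].
by have := ideal_gap_ge k; lra.
Qed.

Lemma well_spaced_not_coincident s tau : well_spaced s tau ->
  ~ coincidence_set T tau.
Proof.
move=> [_ gt0] [_ [i [r [ir E]]]].
wlog lt_ir : i r ir E / ((s^-1)%g i < (s^-1)%g r)%N.
  move=> W; have [lt|lt|E'] := ltngtP ((s^-1)%g i) ((s^-1)%g r).
  - exact: (W i r).
  - by apply: (W r i) => //; rewrite eq_sym.
  - by move/val_inj/perm_inj: E' ir => ->; rewrite eqxx.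
by have := gap_gt0_mono gt0 lt_ir; rewrite !permKV E ltxx.
Qed.

Lemma exists_gap_ge0 tau : cube n.+1 T tau -> exists s, forall k, 0 <= gap s tau k.
Proof.
move=> ct; pose r : rel 'I_n.+1 := fun i j => tau j 0 <= tau i 0.
have rtot : total r by move=> i j; apply: le_total.
have rtr : transitive r by move=> j i k ij jk; apply: le_trans jk ij.
pose l := sort r (enum 'I_n.+1).
have sl : size l = n.+1 by rewrite size_sort size_enum_ord.
have ul : uniq l by rewrite sort_uniq enum_uniq.
pose f (k : 'I_n.+1) := nth ord0 l k.
have finj : injective f.
  by move=> i j /eqP; rewrite nth_uniq ?sl // => /eqP /val_inj.
exists (perm finj) => k; rewrite /gap !permE.
have mono i j : (i <= j < n.+1)%N -> tau (nth ord0 l j) 0 <= tau (nth ord0 l i) 0.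
  move=> /andP[ij jn].
  apply: (sorted_leq_nth rtr _ ord0 (sort_sorted rtot _)) => //.
  - by move=> x; apply: lexx.
  - by rewrite inE sl; lia.
  - by rewrite inE sl.
have [->|kmax] := eqVneq k ord_max.
  by have := ct (f ord_max); have := ct (f (ordS ord_max)); rewrite mul1r; lra.
rewrite mul0r addr0 subr_ge0; apply: mono; rewrite ltn_ord andbT ordS_lt //.
Qed.

(** A vanishing gap is a coincidence, except for the last one, which vanishes when
the highest phase is [T] and the lowest is 0. *)
Lemma exists_well_spaced tau : cube n.+1 T tau -> ~ bad_set n.+1 T tau ->
  exists s, well_spaced s tau.
Proof.
move=> ct nb; have [s ge0] := exists_gap_ge0 ct; exists s; split=> // k.
rewrite lt_neqAle ge0 andbT eq_sym; apply/eqP => k0; apply: nb.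
have [noC|C] := pselect (coincidence_set T tau); first by left.
have [Ek|kmax] := eqVneq k ord_max; last first.
  left; split=> //; exists (s k), (s (ordS k)); split.
    rewrite (inj_eq perm_inj); apply/eqP => /(congr1 (@nat_of_ord _)).
    by rewrite ordS_lt //; lia.
  by move: k0; rewrite /gap (negbTE kmax) mul0r addr0 => /subr0_eq.
right; move: k0; rewrite Ek gap_max => k0.
have := ct (s ord0); have := ct (s ord_max) => c1 c2.
have E1 : tau (s ord0) 0 = T by lra.
have E2 : tau (s ord_max) 0 = 0 by lra.
split; first by split=> //; split=> //; exists (s ord0).
exists (s ord_max), (s ord0); split=> //.
by rewrite (inj_eq perm_inj) -val_eqE /=; lia.
Qed.

(** * Desynchronizing trajectories *)

Context (om : R).
Hypothesis om_gt0 : 0 < om.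
Local Notation H := (oscillators n.+1 T om eps).
Local Notation K := ((n.+1 * n.+1)%:R : R).

Definition flow_to_top (i : 'I_n.+1) tau : 'cV[R]_n.+1 :=
  tau + const_mx (T - tau i 0).

Lemma flow_to_top_max i tau : flow_to_top i tau i 0 = T.
Proof. by rewrite /flow_to_top add_constE addrC subrK. Qed.

Lemma flow_to_top_cube i tau : cube n.+1 T tau ->
  (forall k, tau k 0 <= tau i 0) -> cube n.+1 T (flow_to_top i tau).
Proof.
move=> ct top k; rewrite /flow_to_top add_constE.
by have := ct k; have := ct i; have := top k => *; apply/andP; split; lra.
Qed.

(** Flow until the highest phase, that of [top j], is equal to [T]. *)
Lemma run_of_jumps (q : nat -> 'cV[R]_n.+1) (top : nat -> 'I_n.+1) :
  (forall j, cube n.+1 T (q j)) -> (forall j k, q j k 0 <= q j (top j) 0) ->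
  (forall j, osc_jump_map T eps (flow_to_top (top j) (q j)) (q j.+1)) ->
  is_run T om eps q (fun j => (T - q j (top j) 0) / om).
Proof.
move=> cq topq jq j.
have -> : flow_end om q (fun j => (T - q j (top j) 0) / om) j =
    flow_to_top (top j) (q j).
  by rewrite /flow_end mulrC divfK // gt_eqF.
split=> //.
  by rewrite divr_ge0 ?(ltW om_gt0) // subr_ge0; case/andP: (cq j (top j)).
split; first exact: flow_to_top_cube.
by exists (top j); rewrite flow_to_top_max.
Qed.

(** With several phases at [T] the jump map lets each of them choose between 0 and
(1 + eps) * T: here exactly one chooses 0. *)
Lemma reset_top_jump s tau : cube n.+1 T tau -> tau (s ord0) 0 = T ->
  osc_jump_map T eps tau (reset_top s tau).
Proof.
move=> ct top i; rewrite mxE /osc_jump_comp /=.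
have [->|is0] := eqVneq i (s ord0).
  have [[r [rs rT]]|nr] := pselect (exists r, r != s ord0 /\ tau r 0 = T).
    by apply: Or32; split=> //; [exists r | left].
  apply: Or31; split=> // r rs; rewrite lt_neqAle; have /andP[_ ->] := ct r.
  by rewrite andbT; apply/eqP => rT; apply: nr; exists r.
have ex : exists r, r != i /\ tau r 0 = T by exists (s ord0); rewrite eq_sym.
have [iT|iT] := eqVneq (tau i 0) T; first by apply: Or32; split=> //; right.
apply: Or33; split=> //; rewrite lt_neqAle iT.
by have /andP[_ ->] := ct i.
Qed.

Lemma reset_cube (P : pred 'I_n.+1) tau : cube n.+1 T tau ->
  cube n.+1 T (\col_i (if P i then 0 else a * tau i 0)).
Proof.
move=> ct i; rewrite mxE; case: ifP => _; first by rewrite lexx ltW.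
have /andP[a0 a1] := ratio_itv; have /andP[t0 tT] := ct i.
rewrite mulr_ge0 ?(ltW a0) //=; apply: le_trans tT.
by rewrite ler_piMl // ltW.
Qed.

(** Positive gaps leave [s ord0] as the only oscillator at [T]. *)
Lemma reset_top_unique s tau y : well_spaced s tau -> tau (s ord0) 0 = T ->
  osc_jump_map T eps tau y -> y = reset_top s tau.
Proof.
move=> [ct gt0] top jy; apply/colP => i; rewrite [RHS]mxE; have := jy i.
have lt r : r != s ord0 -> tau r 0 < T.
  move=> rs; rewrite -top -[r](permKV s); apply: gap_gt0_mono => //.
  rewrite lt0n; apply: contra rs => /eqP r0.
  by rewrite -[r](permKV s); apply/eqP; congr (s _); apply: val_inj.
have [->|/[dup] is0 /lt iT] := eqVneq i (s ord0); case=> [].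
- by case.
- by move=> [_ [r [/lt]]] + rT; rewrite rT ltxx.
- by rewrite top ltxx; case.
- by move=> [E]; move: iT; rewrite E ltxx.
- by move=> [E]; move: iT; rewrite E ltxx.
- by case.
Qed.

Definition desync_step (st : 'S_n.+1 * 'cV[R]_n.+1) :=
  (rot_perm st.1, reset_top st.1 (flow_to_top (st.1 ord0) st.2)).

(** The permutation is part of the state: it breaks the ties between coinciding
phases consistently, so that each phase of a group in turn is the one reset. *)
Definition desync_state s tau j := iter j desync_step (s, tau).

Definition desync_traj s tau : hybrid_fun R n.+1 :=
  trajectory om (fun j => (desync_state s tau j).2)
    (fun j => (T - (desync_state s tau j).2 ((desync_state s tau j).1 ord0) 0) / om).

Section desync_run.
Variables (s0 : 'S_n.+1) (tau0 : 'cV[R]_n.+1).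
Hypotheses (ctau0 : cube n.+1 T tau0) (gap0 : forall k, 0 <= gap s0 tau0 k).
Local Notation st := (desync_state s0 tau0).

Lemma gap_flow_to_top s i tau k : gap s (flow_to_top i tau) k = gap s tau k.
Proof. exact: gap_flow. Qed.

Lemma desync_state_sorted j : cube n.+1 T (st j).2 /\
  forall k, 0 <= gap (st j).1 (st j).2 k.
Proof.
have /andP[a0 a1] := ratio_itv.
elim: j => //= j [c g]; split.
  apply: (reset_cube (pred1 _)); apply: flow_to_top_cube => // k.
  by rewrite -[k](permKV (st j).1); apply: gap_ge0_mono.
move=> k; rewrite gap_reset_top ?flow_to_top_max // gap_flow_to_top.
have aT : 0 <= (1 - a) * T by rewrite mulr_ge0 ?(ltW T_gt0) // subr_ge0 ltW.
by apply: addr_ge0; apply: mulr_ge0 => //; exact: ltW.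
Qed.

Lemma desync_state_top j k : (st j).2 k 0 <= (st j).2 ((st j).1 ord0) 0.
Proof.
by rewrite -[k](permKV (st j).1); apply: gap_ge0_mono => //; case: (desync_state_sorted j).
Qed.

Lemma desync_state_close w j : gap_close w s0 tau0 ->
  gap_close (a ^+ j * w) (st j).1 (st j).2.
Proof.
move=> c0; elim: j => [|j IH]; first by rewrite expr0 mul1r.
rewrite exprS -mulrA; apply: gap_close_reset_top; rewrite ?flow_to_top_max //.
exact: gap_close_flow.
Qed.

Lemma desync_state_spaced j : well_spaced s0 tau0 -> well_spaced (st j).1 (st j).2.
Proof.
move=> [_ g0]; split; first by case: (desync_state_sorted j).
have /andP[a0 a1] := ratio_itv; elim: j => //= j IH k.
rewrite gap_reset_top ?flow_to_top_max // gap_flow_to_top.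
have aT : 0 <= (1 - a) * T by rewrite mulr_ge0 ?(ltW T_gt0) // subr_ge0 ltW.
by apply: ltr_pwDl; [exact: mulr_gt0 | exact: mulr_ge0].
Qed.

Lemma desync_run : is_run T om eps (fun j => (st j).2)
  (fun j => (T - (st j).2 ((st j).1 ord0) 0) / om).
Proof.
apply: (@run_of_jumps _ (fun j => (st j).1 ord0)).
- by move=> j; case: (desync_state_sorted j).
- exact: desync_state_top.
move=> j; apply: reset_top_jump; last exact: flow_to_top_max.
apply: flow_to_top_cube; last exact: desync_state_top.
by case: (desync_state_sorted j).
Qed.

Lemma desync_traj_edist w t j : gap_close w s0 tau0 ->
  hdom (desync_traj s0 tau0) (t, j) ->
  edist A (hval (desync_traj s0 tau0) t j) <= K * (a ^+ j * w).
Proof.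
move=> c0 tj; apply: (@edist_le_gap_close _ (st j).1).
  exact: (trajectory_cube om_gt0 desync_run tj).
exact: gap_close_flow (desync_state_close j c0).
Qed.

(** Each flow lasts at most T / om, so t + j can only be large if j is. *)
Lemma desync_traj_converges : converges_to A (desync_traj s0 tau0).
Proof.
have /andP[a0 a1] := ratio_itv.
pose w := \sum_k `|gap s0 tau0 k - ideal_gap k|.
have w0 : 0 <= w by apply: sumr_ge0.
have c0 : gap_close w s0 tau0.
  by move=> k; rewrite /w (bigD1 k) //= lerDl; apply: sumr_ge0.
move=> e e0; have Kw0 : 0 < K * w + 1 by rewrite ltr_wpDl // mulr_ge0.
have [J HJ] : exists J, forall j, (J <= j)%N -> K * (a ^+ j * w) < e.
  have : (fun j => a ^+ j) @ \oo --> (0 : R) by apply: cvg_expr; rewrite gtr0_norm.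
  move/cvgrPdist_lt => /(_ (e / (K * w + 1)) (divr_gt0 e0 Kw0)) [J _ HJ].
  exists J => j Jj; have := HJ j Jj; rewrite /= sub0r normrN gtr0_norm ?exprn_gt0 //.
  rewrite ltr_pdivlMr // => lt; apply: le_lt_trans lt.
  by rewrite mulrCA ler_wpM2l ?exprn_ge0 ?(ltW a0) //; lra.
exists (J.+1%:R * (T / om) + J%:R + 1) => t j tj big.
apply: le_lt_trans (desync_traj_edist c0 tj) _; apply: HJ.
rewrite leqNgt; apply/negP => jJ.
move: tj => /= /andP[_].
have Tom : 0 <= T / om by rewrite divr_ge0 // ltW.
have clk : clock (fun j => (T - (st j).2 ((st j).1 ord0) 0) / om) j.+1 <= j.+1%:R * (T / om).
  rewrite /clock mulr_natl -[j.+1 in leRHS]card_ord -sumr_const.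
  apply: ler_sum => i _; rewrite ler_pM2r ?invr_gt0 // gerBl.
  by have [/(_ ((st i).1 ord0)) /andP[]] := desync_state_sorted i.
have jJ1 : j.+1%:R * (T / om) <= J.+1%:R * (T / om) by rewrite ler_wpM2r // ler_nat ltnW.
have jJ2 : (j%:R : R) <= J%:R by rewrite ler_nat ltnW.
by lra.
Qed.

Hypothesis spaced0 : well_spaced s0 tau0.

Lemma desync_jump_uniq j tau :
  osc_jump_map T eps (flow_end om (fun j => (st j).2)
    (fun j => (T - (st j).2 ((st j).1 ord0) 0) / om) j) tau -> tau = (st j.+1).2.
Proof.
have -> : flow_end om (fun j => (st j).2)
    (fun j => (T - (st j).2 ((st j).1 ord0) 0) / om) j =
    flow_to_top ((st j).1 ord0) (st j).2.
  by rewrite /flow_end mulrC divfK // gt_eqF.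
apply: reset_top_unique; last exact: flow_to_top_max.
have [c g] := desync_state_spaced j spaced0; split.
  by apply: flow_to_top_cube => // k; exact: desync_state_top.
by move=> k; rewrite gap_flow_to_top.
Qed.

Lemma solution_edist w x t j : solution H x -> hval x 0 0%N = tau0 ->
  gap_close w s0 tau0 -> hdom x (t, j) -> edist A (hval x t j) <= K * (a ^+ j * w).
Proof.
move=> sx x0 c0 tj.
have [tj' ->] := solution_sub_trajectory om_gt0 desync_run desync_jump_uniq sx x0 tj.
exact: desync_traj_edist.
Qed.

Lemma maximal_solution_converges x : maximal_solution H x -> hval x 0 0%N = tau0 ->
  complete_arc x /\ converges_to A x.
Proof.
move=> mx x0.
have E := maximal_trajectory om_gt0 desync_run desync_jump_uniq mx x0.
split.
  move=> [M HM]; apply: (trajectory_complete desync_run) => //; exists M => t j tj.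
  by apply: HM; apply/E.
move=> e e0; have [M HM] := desync_traj_converges e0; exists M => t j tj Mt.
have [tj' ->] := solution_sub_trajectory om_gt0 desync_run desync_jump_uniq mx.1 x0 tj.
exact: HM.
Qed.

End desync_run.

Definition top_index tau : 'I_n.+1 := [arg max_(i > ord0) tau i 0]%O.

Lemma top_indexP tau k : tau k 0 <= tau (top_index tau) 0.
Proof. by rewrite /top_index; case: Order.TotalTheory.arg_maxP => // i _; apply. Qed.

(** The other extreme choice at a jump, which keeps equal phases equal. *)
Definition reset_all tau : 'cV[R]_n.+1 :=
  \col_i (if tau i 0 == T then 0 else a * tau i 0).

Definition sync_state tau j :=
  iter j (fun tau => reset_all (flow_to_top (top_index tau) tau)) tau.

Lemma reset_all_jump tau : osc_jump_set T tau ->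
  osc_jump_map T eps tau (reset_all tau).
Proof.
move=> [ct [i0 top]] i; rewrite mxE /osc_jump_comp /=.
have [iT|iT] := eqVneq (tau i 0) T.
  have [ex|nr] := pselect (exists r, r != i /\ tau r 0 = T).
    by apply: Or32; split=> //; left.
  apply: Or31; split=> // r rs; rewrite lt_neqAle; have /andP[_ ->] := ct r.
  by rewrite andbT; apply/eqP => rT; apply: nr; exists r.
apply: Or33; split=> //; first by rewrite lt_neqAle iT; have /andP[_ ->] := ct i.
exists i0; split=> //; apply: contra_neq iT => <- //.
Qed.

Lemma sync_state_cube tau j : cube n.+1 T tau -> cube n.+1 T (sync_state tau j).
Proof.
move=> ct; elim: j => //= j IH; apply: (reset_cube (fun i => _ == _)).
apply: flow_to_top_cube => // k.
exact: top_indexP.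
Qed.

(** Resetting all the phases at [T] at each jump keeps a coincidence forever. For
a point with phases 0 and [T], the first jump is immediate and creates one. *)
Lemma bad_not_basin tau : bad_set n.+1 T tau -> ~ basin_of_attraction H A tau.
Proof.
move=> bad [_ all].
have ct : cube n.+1 T tau by case: bad => [[]|[[[]]]].
pose q := sync_state tau; pose top j := top_index (q j).
have run : is_run T om eps q (fun j => (T - q j (top j) 0) / om).
  apply: run_of_jumps => [j|j k|j]; [exact: sync_state_cube | exact: top_indexP |].
  apply: reset_all_jump; split; last by exists (top j); rewrite flow_to_top_max.
  by apply: flow_to_top_cube => [|k]; [exact: sync_state_cube | exact: top_indexP].
have coin j : coincidence_set T (q j.+1).
  split; first exact: sync_state_cube.
  have step k i r : i != r -> q k i 0 = q k r 0 -> q k.+1 i 0 = q k.+1 r 0.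
    by move=> _ E; rewrite !mxE E.
  have [i [r [ir E]]] : exists i r, i != r /\ q 1 i 0 = q 1 r 0.
    case: bad => [[_ [i [r [ir E]]]]|[_ [i [r [ir i0 rT]]]]]; exists i, r; split=> //.
      by rewrite !mxE E.
    (* Some phase is already at [T], so the first jump is immediate. *)
    have topT : tau (top_index tau) 0 = T.
      apply/eqP; rewrite eq_le; apply/andP; split; first by case/andP: (ct (top_index tau)).
      by rewrite -[leLHS]rT; exact: top_indexP.
    rewrite /q /= !mxE topT subrr !addr0 i0 rT eqxx.
    by rewrite lt_eqF // mulr0.
  exists i, r; split=> //; elim: j => // j; exact: step.
have start : hval (trajectory om q (fun j => (T - q j (top j) 0) / om)) 0 0%N = tau.
  have [_] := trajectory_start run 0; rewrite clock0; exact.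
have [_ conv] := all _ (trajectory_maximal om_gt0 run) start.
have m0 := min_gap_gt0.
have [M HM] := conv (min_gap / 4) (divr_gt0 m0 (ltr0n _ 4)).
pose j := Num.bound `|M|.
have Mj : `|M| < j%:R by apply: archi_boundP.
have [dj vj] := trajectory_start run j.+1.
have near_A : edist A (q j.+1) < min_gap / 4.
  rewrite -vj; apply: HM dj _; have := clock_ge0 run j.+1; have := ler_norm M.
  by rewrite -natr1; set c := clock _ _; lra.
have [s cs] := edist_lt_gap_close near_A.
have ws : well_spaced s (q j.+1).
  by apply: (gap_close_well_spaced (sync_state_cube _ ct) _ cs); lra.
exact: (well_spaced_not_coincident ws) (coin j).
Qed.

Lemma solution_start_cube x : solution H x -> cube n.+1 T (hval x 0 0%N).
Proof. by case=> _ [_ C] _ _; case: C => [c|[c _]]; exact: c. Qed.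

(** The distance is an infimum: a bound [d] gives a point of the set at distance
less than 2 * d, and each gap is a difference of two phases. *)
Lemma near_desync_set tau d : cube n.+1 T tau -> 4 * d < min_gap -> 0 < d ->
  edist A tau <= d -> exists2 s, well_spaced s tau & gap_close (4 * d) s tau.
Proof.
move=> ct dm d0 td.
have [s cs] : exists s, gap_close (2 * (2 * d)) s tau.
  by apply: edist_lt_gap_close; lra.
have E : 2 * (2 * d) = 4 * d by ring.
by exists s; rewrite -?E //; apply: (gap_close_well_spaced ct _ cs); rewrite E.
Qed.

(** From a well spaced point the deviation of the gaps never increases, so only
the conversions between distance and gaps matter. *)
Lemma desync_set_stable : stable H A.
Proof.
move=> e e0; have m0 := min_gap_gt0; have K0 : 0 < K by rewrite ltr0n.
pose d := Num.min (e / (4 * K)) (min_gap / 8).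
have K4 : 0 < 4 * K by rewrite mulr_gt0.
have d0 : 0 < d by rewrite lt_min (divr_gt0 e0 K4) (divr_gt0 m0).
have dm : 4 * d < min_gap.
  have : d <= min_gap / 8 by rewrite ge_min lexx orbT.
  by lra.
have de : K * (4 * d) <= e.
  have : d <= e / (4 * K) by rewrite ge_min lexx.
  by rewrite ler_pdivlMr //; lra.
exists d => // x sx xd t j tj.
have [s ws cs] := near_desync_set (solution_start_cube sx) dm d0 xd.
have /andP[a0 a1] := ratio_itv.
apply: le_trans (solution_edist ws.1 (fun k => ltW (ws.2 k)) ws sx erefl cs tj) _.
apply: le_trans de; rewrite ler_wpM2l ?(ltW K0) //.
by rewrite ler_piMl ?exprn_ile1 ?(ltW a0) ?(ltW a1) // mulr_ge0 ?(ltW d0).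
Qed.

Lemma desync_set_attractive : attractive H A.
Proof.
have m0 := min_gap_gt0; exists (min_gap / 8); first exact: divr_gt0.
move=> x mx xd.
have [|s ws cs] := near_desync_set (solution_start_cube mx.1) _ (divr_gt0 m0 (ltr0n _ 8)) xd.
  by lra.
exact: (maximal_solution_converges ws.1 (fun k => ltW (ws.2 k)) ws mx erefl).
Qed.

Lemma desync_set_basin :
  basin_of_attraction H A = cube n.+1 T `\` bad_set n.+1 T.
Proof.
apply/seteqP; split=> [tau b|tau [ct nb]].
  split; last by move=> /bad_not_basin; apply.
  by case: b => [C _]; case: C => [c|[c _]]; exact: c.
split; first by left.
have [s ws] := exists_well_spaced ct nb => x mx x0.
exact: (maximal_solution_converges ws.1 (fun k => ltW (ws.2 k)) ws mx x0).
Qed.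

Lemma desync_set_weakly_attractive tau : cube n.+1 T tau ->
  exists x, [/\ maximal_solution H x, hval x 0 0%N = tau,
                 complete_arc x & converges_to A x].
Proof.
move=> ct; have [s g0] := exists_gap_ge0 ct.
have run := desync_run ct g0; exists (desync_traj s tau).
have mx := trajectory_maximal om_gt0 run; have co := trajectory_complete run.
split=> //; last exact: desync_traj_converges.
by have [_ E] := trajectory_start run 0; move: E; rewrite clock0.
Qed.

End gaps.

Theorem theorem3p3 (R : realType) (N : nat) (taubar omega eps : R)
    (hN : (1 < N)%N) (htaubar : 0 < taubar) (homega : 0 < omega)
    (heps : -1 < eps < 0) :
  let H := oscillators N taubar omega eps in
  let A := desync_set N taubar eps in
  compact A /\
  (asymptotically_stable H A /\
   basin_of_attraction H A = cube N taubar `\` bad_set N taubar) /\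
  weakly_globally_asymptotically_stable H A.
Proof.
case: N hN => [//|n] n_gt0 /=.
have stab := desync_set_stable n_gt0 htaubar heps homega.
split; first exact: desync_set_compact.
split; first split; [split=> //; exact: desync_set_attractive | exact: desync_set_basin |].
split=> // tau C; apply: desync_set_weakly_attractive => //.
by case: C => [c|[c _]]; exact: c.
Qed.
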